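(* Let $G$ be a connected graph of order $n$ with $m$ edges, maximum degree $\Delta$, minimum non-pendent vertex degree $\delta_1$, and $p$ pendent vertices. Then \[ AG(G) \le \frac{p(\Delta+1)}{2\sqrt{\Delta}} + \frac{1}{2\delta_1}\sqrt{(m-p)\bigl(F + 2M_2 - p(\delta_1+1)^2\bigr)}, \] with equality if and only if $G$ is isomorphic to $K_{1,n-1}$, or $G$ is a regular graph, or $G$ is a $(\Delta,1)$-semiregular graph.
   Context: All graphs are finite, simple and undirected. For a graph $G$ with vertices $v_1,\dots,v_n$, $d_i$ denotes the degree of $v_i$, and $i\sim j$ denotes an edge $v_iv_j$; sums over $i\sim j$ run over the edges, each edge once. A pendent vertex is a vertex of degree $1$; $p$ is the number of pendent vertices. $\delta_1$ is the minimum degree among non-pendent vertices. $AG(G)=\sum_{i\sim j}\frac12\left(\sqrt{d_i/d_j}+\sqrt{d_j/d_i}\right)$, $F(G)=\sum_{i=1}^n d_i^3=\sum_{i\sim j}(d_i^2+d_j^2)$, $M_2(G)=\sum_{i\sim j} d_id_j$. A graph is $(s,r)$-semiregular if its vertex set is the disjoint union of two nonempty sets $V_1,V_2$ with every vertex in $V_1$ of degree $s$ and every vertex in $V_2$ of degree $r$. $K_{1,n-1}$ is the star on $n$ vertices. *)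

(* Defs.v *)
From HB Require Import structures.
From mathcomp Require Import all_boot all_order all_algebra.

Set Implicit Arguments.
Unset Strict Implicit.
Unset Printing Implicit Defensive.

Import Order.TTheory GRing.Theory Num.Theory.

Record sgraph := SGraph {
  vertex :> finType;
  adj : rel vertex;
  adj_sym : symmetric adj;
  adj_irrefl : irreflexive adj
}.

Section Graph.
Variable G : sgraph.

Definition connected : Prop := 0 < #|G| /\ forall x y : G, connect (@adj G) x y.

Definition deg (x : G) : nat := #|[set y | adj x y]|.

(* Each edge occurs exactly once, as the pair of its endpoints listed in
   increasing order of the enumeration of the vertices. *)
Definition edges : {set G * G} :=
  [set xy | adj xy.1 xy.2 && (enum_rank xy.1 < enum_rank xy.2)].

Definition num_edges : nat := #|edges|.

Definition pendent (x : G) : bool := deg x == 1.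

Definition num_pendent : nat := #|[set x | pendent x]|.

Definition max_deg : nat := \max_(x : G) deg x.

(* Since deg x < #|G|, the default value #|G| only matters when every vertex
   is pendent, in which case the minimum is undefined. *)
Definition min_nonpendent_deg : nat :=
  \big[minn/#|G|]_(x : G | ~~ pendent x) deg x.

Definition forgotten_index : nat := \sum_(x : G) deg x ^ 3.

Definition zagreb2 : nat := \sum_(xy in edges) deg xy.1 * deg xy.2.

Definition regular : Prop := exists r : nat, forall x : G, deg x = r.

Definition semiregular (s r : nat) : Prop :=
  exists V1 V2 : {set G},
    [/\ V1 :|: V2 = setT, [disjoint V1 & V2], V1 != set0, V2 != set0
      & (forall x, x \in V1 -> deg x = s) /\ (forall x, x \in V2 -> deg x = r)].

End Graph.

Definition isomorphic (G H : sgraph) : Prop :=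
  exists f : G -> H, bijective f /\ forall x y : G, adj (f x) (f y) = adj x y.

Section CompleteBipartite.
Variables a b : nat.

Definition is_inl (x : 'I_a + 'I_b) : bool := if x is inl _ then true else false.

Definition bip_adj : rel ('I_a + 'I_b)%type := fun x y => is_inl x != is_inl y.

Lemma bip_adj_sym : symmetric bip_adj.
Proof. by move=> x y; rewrite /bip_adj eq_sym. Qed.

Lemma bip_adj_irrefl : irreflexive bip_adj.
Proof. by move=> x; rewrite /bip_adj eqxx. Qed.

Definition complete_bipartite : sgraph := SGraph bip_adj_sym bip_adj_irrefl.

End CompleteBipartite.

Section ArithmeticGeometric.
Local Open Scope ring_scope.

Definition AG (R : rcfType) (G : sgraph) : R :=
  \sum_(xy in edges G)
     2^-1 * (Num.sqrt ((deg xy.1)%:R / (deg xy.2)%:R)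
             + Num.sqrt ((deg xy.2)%:R / (deg xy.1)%:R)).

End ArithmeticGeometric.

(* Main.v *)
Require Import Defs.
From HB Require Import structures.
From mathcomp Require Import all_boot all_order all_algebra.
From mathcomp Require Import ring lra.

Set Implicit Arguments.
Unset Strict Implicit.
Unset Printing Implicit Defensive.

Import Order.TTheory GRing.Theory Num.Theory.
Local Open Scope ring_scope.

(** Write ag a b = (sqrt (a/b) + sqrt (b/a)) / 2 = (a + b) / (2 sqrt (a b)).
    An edge joining a pendent vertex to a vertex of degree a contributes
    ag a 1, which increases with a >= 1 and so is at most ag Delta 1; any other
    edge contributes at most (a + b) / (2 delta1).  Connectedness and the
    existence of a non-pendent vertex make the pendent edges correspond to the
    pendent vertices.  Cauchy-Schwarz bounds the sum of a + b over the m - p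
    other edges, since F + 2 M2 is the sum of (a + b)^2 over all edges, of which
    the pendent ones account for at least p (delta1 + 1)^2.

    In the case of equality the pendent edges force a = Delta, the others force
    a = b = delta1, and the last estimate forces m = p, p = 0 or
    Delta = delta1.  Together this means that every non-pendent vertex has degree
    Delta, i.e. that the graph is regular or (Delta,1)-semiregular; the star on
    at least 3 vertices is an instance of the latter, so it never has to be
    recognized as such.  The one-vertex graph, for which delta1 = 0, is treated
    apart. *)

(** * Real inequalities for a single edge, and Cauchy-Schwarz *)

Section RealInequalities.
Variable R : rcfType.
Implicit Types a b d u v : R.

Definition ag a b : R := 2^-1 * (Num.sqrt (a / b) + Num.sqrt (b / a)).

Lemma agC a b : ag a b = ag b a.
Proof. by rewrite /ag addrC. Qed.

Lemma ag_sqr u v : 0 < u -> 0 < v ->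
  ag (u ^+ 2) (v ^+ 2) = (u ^+ 2 + v ^+ 2) / (2 * (u * v)).
Proof.
move=> u0 v0; rewrite /ag -!expr_div_n !sqrtr_sqr !ger0_norm ?divr_ge0 ?ltW //.
by field; rewrite !gt_eqF.
Qed.

(** The left side is [(a + b) / (2 * sqrt (a * b))], and [sqrt (a * b) >= d], strictly unless both
    arguments equal [d]. *)
Lemma ag_leif_lower_bound d a b : 0 < d -> d <= a -> d <= b ->
  ag a b <= (2 * d)^-1 * (a + b) ?= iff (a == d) && (b == d).
Proof.
move=> d0 da db.
have a0 := lt_le_trans d0 da; have b0 := lt_le_trans d0 db.
rewrite -{1}(sqr_sqrtr (ltW a0)) -{1}(sqr_sqrtr (ltW b0)) ag_sqr ?sqrtr_gt0 //.
rewrite -sqrtrM ?ltW // !sqr_sqrtr ?ltW // [X in X <= _ ?= iff _]mulrC.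
apply/leifP; case: ifPn => [/andP[/eqP-> /eqP->]|neq].
  by rewrite -expr2 sqrtr_sqr ger0_norm ?ltW.
rewrite ltr_pM2r ?addr_gt0 // ltf_pV2 ?posrE ?mulr_gt0 ?sqrtr_gt0 ?mulr_gt0 //.
rewrite ltr_pM2l // -[ltLHS]ger0_norm ?ltW // -sqrtr_sqr ltr_sqrt ?mulr_gt0 //.
move: neq; rewrite negb_and => /orP[] ne.
  have {ne da} : d < a by rewrite lt_def ne.
  by move=> ?; nra.
have {ne db} : d < b by rewrite lt_def ne.
by move=> ?; nra.
Qed.

Lemma ag1_leif a d : 1 <= a -> a <= d ->
  ag a 1 <= (d + 1) / (2 * Num.sqrt d) ?= iff (a == d).
Proof.
move=> a1 ad; have a0 := lt_le_trans ltr01 a1.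
have d0 := lt_le_trans a0 ad.
rewrite -{1}(sqr_sqrtr (ltW a0)) -{1}(expr1n _ 2) ag_sqr ?sqrtr_gt0 //.
rewrite -[d in d + 1](sqr_sqrtr (ltW d0)) expr1n mulr1; apply/leifP.
case: ifPn => [/eqP->//|ne].
have: 1 <= Num.sqrt a by rewrite -sqrtr1 ler_sqrt // ltW.
have: Num.sqrt a < Num.sqrt d by rewrite ltr_sqrt // lt_def eq_sym ne ad.
move: (Num.sqrt a) (Num.sqrt d) => u v uv u1.
have u0 : 0 < u by lra.
have v0 : 0 < v by lra.
rewrite -subr_gt0.
(* The map [u |-> (u + 1 / u) / 2] increases on [u >= 1]: the difference factors, and [1 <= u < v]
   gives [u * v > 1]. *)
have ->: (v ^+ 2 + 1) / (2 * v) - (u ^+ 2 + 1) / (2 * u) =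
   (v - u) * (u * v - 1) / (2 * (u * v)).
  by field; rewrite !gt_eqF.
by rewrite divr_gt0 ?mulr_gt0 ?subr_gt0 //; nra.
Qed.

(** Cauchy-Schwarz against the constant 1: sum [f i * f j <= (f i ^+ 2 + f j ^+ 2) / 2] over all
    pairs. *)
Lemma sqr_sum_le (I : finType) (A : {pred I}) (f : I -> R) :
  (\sum_(i in A) f i) ^+ 2 <= #|A|%:R * \sum_(i in A) f i ^+ 2.
Proof.
have AM i j : f i * f j <= 2^-1 * (f i ^+ 2 + f j ^+ 2).
  by have := sqr_ge0 (f i - f j); nra.
have -> : (\sum_(i in A) f i) ^+ 2 = \sum_(i in A) \sum_(j in A) f i * f j.
  by rewrite expr2 mulr_suml; apply: eq_bigr => i _; rewrite mulr_sumr.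
apply: (le_trans (ler_sum _ (fun i _ => ler_sum _ (fun j _ => AM i j)))).
under eq_bigr do rewrite -mulr_sumr big_split /= sumr_const.
rewrite -mulr_sumr big_split /= sumr_const sumrMnl -mulr2n -[X in _ * X]mulr_natl.
by rewrite mulKf ?pnatr_eq0 // mulr_natl.
Qed.

End RealInequalities.

(** * Degree sums, extreme degrees and pendent vertices *)

Section Graph.
Variable G : sgraph.
Implicit Types (x y : G) (e : G * G).

(** Ordered adjacent pairs split by the order of their ranks; swapping the coordinates carries the
    decreasing half to [edges G]. *)
Lemma handshake (V : nmodType) (f : G -> G -> V) :
  \sum_(e in edges G) (f e.1 e.2 + f e.2 e.1) =
  \sum_x \sum_(y | adj x y) f x y.
rewrite pair_big_dep big_split /=.
rewrite [RHS](bigID (fun e => (enum_rank e.1 < enum_rank e.2)%N)) /=.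
congr (_ + _).
  by apply: eq_bigl => e; rewrite inE.
rewrite [RHS](reindex_inj (h := fun e => (e.2, e.1))) /=; last first.
  by move=> [x y] [x' y'] [-> ->].
apply: eq_bigl => -[x y]; rewrite inE /= [adj y x]adj_sym.
case xy: (adj x y) => //=; case: ltngtP => // /ord_inj/enum_rank_inj exy.
by rewrite exy adj_irrefl in xy.
Qed.

Lemma sum_deg (V : nmodType) (g : G -> V) :
  \sum_(e in edges G) (g e.1 + g e.2) = \sum_x g x *+ deg x.
Proof.
rewrite (handshake (fun x _ => g x)); apply: eq_bigr => x _.
by rewrite /deg cardsE sumr_const.
Qed.

Lemma adj_edges x y : adj x y -> ((x, y) \in edges G) || ((y, x) \in edges G).
Proof.
move=> xy; rewrite !inE /= xy adj_sym xy /=.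
case: ltngtP => // /ord_inj/enum_rank_inj exy.
by rewrite exy adj_irrefl in xy.
Qed.

Lemma deg_le_max x : (deg x <= max_deg G)%N.
Proof. exact: leq_bigmax. Qed.

Lemma max_deg_attained : (0 < #|G|)%N -> exists x : G, deg x = max_deg G.
Proof.
by move=> G0; have [x ex] := bigop.eq_bigmax (@deg G) G0; exists x; rewrite -ex.
Qed.

Lemma min_nonpendent_le x : ~~ pendent x -> (min_nonpendent_deg G <= deg x)%N.
Proof.
move=> px; rewrite /min_nonpendent_deg.
have -> : minn = Order.min by [].
by rewrite -leEnat; apply: bigmin_le_cond.
Qed.

(** The first hypothesis covers the default value [#|G|] of the minimum. *)
Lemma min_nonpendent_ge d : (d <= #|G|)%N ->
  (forall x, ~~ pendent x -> (d <= deg x)%N) -> (d <= min_nonpendent_deg G)%N.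
Proof.
move=> dG dx; apply: (big_ind (leq d)) => // a b da db.
by rewrite leq_min da.
Qed.

Lemma deg_gt0_adj x : (0 < deg x)%N -> exists y, adj x y.
Proof. by case/card_gt0P=> y; rewrite inE; exists y. Qed.

(** An isolated vertex is closed under adjacency, so connectedness would make it the whole graph. *)
Lemma connected_deg_gt0 x : connected G -> (1 < #|G|)%N -> (0 < deg x)%N.
Proof.
move=> Gconn G1; rewrite lt0n; apply/negP => /eqP/cards0_eq x0.
have cl : closed (@adj G) (pred1 x).
  apply: intro_closed => [|y z]; first exact: sym_connect_sym (@adj_sym G).
  by move=> yz /eqP ey; move/setP/(_ z): x0; rewrite !inE -ey yz.
have : (#|G| <= #|pred1 x|)%N.
  apply/subset_leq_card/subsetP => y _.
  by rewrite -(closed_connect cl (Gconn.2 x y)) inE.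
by rewrite card1 leqNgt G1.
Qed.

(** Two adjacent pendent vertices have no other neighbours, so they would form all of [G], leaving
    no room for [z]. *)
Lemma pendent_adj_nonpendent x y :
  connected G -> (exists z : G, ~~ pendent z) ->
  adj x y -> pendent x -> ~~ pendent y.
Proof.
move=> Gconn [z pz] xy px; apply/negP => py.
have nb (u v w : G) : pendent u -> adj u v -> adj u w -> w = v.
  move=> /cards1P[t ut] uv uw.
  by move/setP: ut => ut; have := ut v; have := ut w; rewrite !inE uv uw =>
    /esym/eqP-> /esym/eqP->.
have cl : closed (@adj G) (pred2 x y).
  apply: intro_closed => [|u v]; first exact: sym_connect_sym (@adj_sym G).
  move=> uv /pred2P[] eu; rewrite eu in uv.
    by rewrite (nb _ _ _ px xy uv) !inE eqxx orbT.
  by rewrite (nb _ x _ py _ uv) ?inE ?eqxx // adj_sym.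
have := closed_connect cl (Gconn.2 x z); rewrite !inE eqxx /= => /esym/orP.
by case=> /eqP ez; rewrite ez ?px ?py in pz.
Qed.

End Graph.

(** * Degrees under isomorphism and in a star *)

Lemma isomorphic_deg (G H : sgraph) (f : G -> H) : bijective f ->
  (forall x y, adj (f x) (f y) = adj x y) -> forall x, deg (f x) = deg x.
Proof.
move=> bf fadj x; rewrite /deg -(on_card_preimset (onW_bij _ bf)).
by apply: eq_card => y; rewrite !inE fadj.
Qed.

Lemma star_deg_inl k (i : 'I_1) : deg (inl i : complete_bipartite 1 k) = k.
Proof.
rewrite /deg -[RHS](card_ord k) -cardsT -(card_imset _ (@inr_inj 'I_1 'I_k)).
apply: eq_card => -[j|j]; rewrite !inE.
  by symmetry; apply/imsetP => -[].
by symmetry; apply/imsetP; exists j.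
Qed.

Lemma star_deg_inr k (i : 'I_k) : deg (inr i : complete_bipartite 1 k) = 1%N.
Proof.
apply/eqP/cards1P; exists (inl ord0); apply/setP => -[j|j]; rewrite !inE //.
by rewrite ord1 eqxx.
Qed.

(** * Pendent and non-pendent edges, and tightness *)

Section Bound.
Variable G : sgraph.
Implicit Types (x y : G) (e : G * G).

Definition pendent_edges : {set G * G} :=
  [set e in edges G | pendent e.1 || pendent e.2].

Definition nonpendent_edges : {set G * G} := edges G :\: pendent_edges.

Lemma pendent_edges_sub : pendent_edges \subset edges G.
Proof. by apply/subsetP => e; rewrite inE => /andP[]. Qed.

Lemma card_nonpendent_edges :
  #|nonpendent_edges| = (num_edges G - #|pendent_edges|)%N.
Proof. by rewrite cardsDS ?pendent_edges_sub. Qed.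

Lemma sum_edges (V : nmodType) (g : G * G -> V) :
  \sum_(e in edges G) g e =
  \sum_(e in pendent_edges) g e + \sum_(e in nonpendent_edges) g e.
Proof.
rewrite (big_setID pendent_edges) /=; congr (_ + _).
by rewrite (setIidPr pendent_edges_sub).
Qed.

(** A pendent edge has exactly one pendent end, so [sum_deg] applied to the indicator of [pendent]
    counts these edges; each pendent vertex has weight [deg x = 1]. *)
Lemma card_pendent_edges : connected G -> (exists x, ~~ pendent x) ->
  #|pendent_edges| = num_pendent G.
Proof.
move=> Gconn Gnp; rewrite /num_pendent -!sum1_card.
have -> : (\sum_(x in [set x : G | pendent x]) 1)%N =
          \sum_(x : G) (pendent x : nat) *+ deg x.
  rewrite big_mkcond; apply: eq_bigr => x _; rewrite inE.
  by case: ifP => [/eqP->|_] //=; rewrite mul0rn.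
rewrite -sum_deg sum_edges [X in _ = _ + X]big1 ?addr0; last first.
  move=> e; rewrite !inE; case: (adj _ _ && _) => //=.
  by rewrite andbT negb_or => /andP[/negPf-> /negPf->].
apply: eq_bigr => e; rewrite !inE => /andP[/andP[ee _]] /orP[] pe.
  by rewrite pe (negPf (pendent_adj_nonpendent Gconn Gnp ee pe)).
rewrite adj_sym in ee.
by rewrite pe (negPf (pendent_adj_nonpendent Gconn Gnp ee pe)).
Qed.

Lemma forgotten_zagreb2 : (forgotten_index G + 2 * zagreb2 G)%N =
  (\sum_(e in edges G) (deg e.1 + deg e.2) ^ 2)%N.
Proof.
have -> : forgotten_index G = \sum_(e in edges G) (deg e.1 ^ 2 + deg e.2 ^ 2)%N.
  rewrite (sum_deg (fun x => deg x ^ 2)%N); apply: eq_bigr => x _.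
  by rewrite expnSr -[RHS]mulr_natr natn.
rewrite /zagreb2 big_distrr -big_split /=; apply: eq_bigr => e _.
by rewrite sqrnD.
Qed.

Definition tight c x := pendent x || (deg x == c).

(** The degree that equality in the estimate for [e] imposes on its non-pendent ends. *)
Definition edge_target e : nat :=
  if e \in pendent_edges then max_deg G else min_nonpendent_deg G.

Definition tight_edge e :=
  tight (edge_target e) e.1 && tight (edge_target e) e.2.

Lemma nonpendent_edge_tightE e : e \in nonpendent_edges ->
  tight_edge e = (deg e.1 == min_nonpendent_deg G) &&
                 (deg e.2 == min_nonpendent_deg G).
Proof.
rewrite inE => /andP[pe ee]; rewrite /tight_edge /tight /edge_target (negPf pe).
by move: pe; rewrite inE ee negb_or => /andP[/negPf-> /negPf->].
Qed.

Hypothesis Gconn : connected G.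
Hypothesis G_gt1 : (1 < #|G|)%N.
Hypothesis Gnonpendent : exists x, ~~ pendent x.

(** Tightness sets the degree of a non-pendent vertex to the maximum or the minimum, according to an
    incident edge; the disjunction, which comes from equality in the summed estimate, reconciles the
    two values. *)
Lemma tight_edgesP :
  (forall e, e \in edges G -> tight_edge e) /\
    [|| #|nonpendent_edges| == 0, num_pendent G == 0
      | max_deg G == min_nonpendent_deg G]%N <->
  (forall x, ~~ pendent x -> deg x = max_deg G).
Proof.
have maxmin : (forall x, ~~ pendent x -> deg x = max_deg G) ->
    max_deg G = min_nonpendent_deg G.
  move=> maxG; apply/eqP; rewrite eqn_leq.
  have [z pz] := Gnonpendent.
  rewrite -{2}(maxG _ pz) min_nonpendent_le // andbT.
  apply: min_nonpendent_ge => [|x /maxG->//].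
  by rewrite -(maxG _ pz) max_card.
split=> [[te H] x px|maxG]; last first.
  split; last by rewrite -maxmin // eqxx !orbT.
  move=> e _; rewrite /tight_edge /edge_target -maxmin // if_same /tight.
  by apply/andP; split; case: (boolP (pendent _)) => // /maxG->; rewrite eqxx.
have incident y : ~~ pendent y ->
    exists2 e, e \in edges G & deg y = edge_target e.
  move=> py; have [z yz] := deg_gt0_adj (connected_deg_gt0 y Gconn G_gt1).
  case/orP: (adj_edges yz) => ee; have := te _ ee => /andP[].
    by rewrite /tight /= (negPf py) => /eqP ye _; exists (y, z).
  by rewrite /tight /= (negPf py) => _ /eqP ye; exists (z, y).
have [e ee ->] := incident x px.
rewrite /edge_target; case: ifP => // pe.
(* Here [e] is non-pendent, so its target is the minimum, and [e] itself excludes the first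
   alternative. *)
case/or3P: H => [||/eqP//].
  move=> /eqP/cards0_eq/setP/(_ e).
  by rewrite inE pe ee inE.
(* Without pendent edges, a vertex of maximum degree lies on a non-pendent edge, whose target is the
   minimum. *)
rewrite -(card_pendent_edges Gconn Gnonpendent) => /eqP/cards0_eq pG0.
have [|y <-] := max_deg_attained (G := G); first exact: ltnW.
have py : ~~ pendent y.
  have [z yz] := deg_gt0_adj (connected_deg_gt0 y Gconn G_gt1).
  apply/negP => py; case/orP: (adj_edges yz) => f.
    by move/setP/(_ (y, z)): pG0; rewrite !inE in f *; rewrite f /= py.
  by move/setP/(_ (z, y)): pG0; rewrite !inE in f *; rewrite f /= py orbT.
have [f _ ->] := incident y py.
by rewrite /edge_target pG0 inE.
Qed.

(** * Summed estimates with their equality cases *)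

Variable R : rcfType.
Let Delta : R := (max_deg G)%:R.
Let delta : R := (min_nonpendent_deg G)%:R.
Let s e : R := (deg e.1)%:R + (deg e.2)%:R.
(** This is [ag Delta 1], the bound for one pendent edge. *)
Let W : R := (Delta + 1) / (2 * Num.sqrt Delta).

Lemma delta_gt0 : 0 < delta.
Proof.
rewrite ltr0n; apply: min_nonpendent_ge => [|x _]; first exact: ltnW.
exact: connected_deg_gt0.
Qed.

Lemma pendent_edge_cases e : e \in pendent_edges ->
  exists x, [/\ ~~ pendent x, s e = (deg x)%:R + 1,
     ag (deg e.1)%:R (deg e.2)%:R = ag (deg x)%:R 1 :> R &
     tight_edge e = (deg x == max_deg G)].
Proof.
move=> pe; rewrite /tight_edge /tight /edge_target pe /s.
move: pe; rewrite !inE => /andP[/andP[ee _]] /orP[] p1.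
  have p2 := pendent_adj_nonpendent Gconn Gnonpendent ee p1.
  exists e.2; rewrite (negPf p2) p1 /=; split=> //; rewrite (eqP p1).
    by rewrite addrC.
  exact: agC.
rewrite adj_sym in ee; have p2 := pendent_adj_nonpendent Gconn Gnonpendent ee p1.
by exists e.1; rewrite (negPf p2) p1 /= andbT; split=> //; rewrite (eqP p1).
Qed.

Lemma pendent_edge_leif e : e \in pendent_edges ->
  ag (deg e.1)%:R (deg e.2)%:R <= W ?= iff tight_edge e.
Proof.
move=> /pendent_edge_cases[x [px _ -> ->]].
rewrite -(eqr_nat R); apply: ag1_leif; last by rewrite ler_nat deg_le_max.
by rewrite ler1n connected_deg_gt0.
Qed.

Lemma nonpendent_edge_leif e : e \in nonpendent_edges ->
  ag (deg e.1)%:R (deg e.2)%:R <= (2 * delta)^-1 * s e ?= iff tight_edge e.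
Proof.
move=> ne; rewrite nonpendent_edge_tightE // -!(eqr_nat R).
move: ne; rewrite inE => /andP[+ ee]; rewrite inE ee negb_or => /andP[p1 p2].
by apply: ag_leif_lower_bound; rewrite ?delta_gt0 // ler_nat min_nonpendent_le.
Qed.

Let k : R := #|nonpendent_edges|%:R.
Let p : R := (num_pendent G)%:R.
Let S1 : R := \sum_(e in nonpendent_edges) s e.
Let Q : R := (forgotten_index G)%:R + 2 * (zagreb2 G)%:R - p * (delta + 1) ^+ 2.

Lemma AG_leif : AG R G <= p * W + (2 * delta)^-1 * S1
  ?= iff [forall (e | e \in edges G), tight_edge e].
Proof.
have -> : p * W = \sum_(e in pendent_edges) W.
  by rewrite sumr_const card_pendent_edges // mulr_natl.
rewrite mulr_sumr.
pose t e := if e \in pendent_edges then W else (2 * delta)^-1 * s e.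
have -> : \sum_(e in pendent_edges) W +
    \sum_(e in nonpendent_edges) (2 * delta)^-1 * s e = \sum_(e in edges G) t e.
  rewrite sum_edges; congr (_ + _); apply: eq_bigr => e; rewrite /t; first by move->.
  by rewrite inE => /andP[/negPf->].
apply: leif_sum => e ee; rewrite /t; case: ifPn => pe; first exact: pendent_edge_leif.
by apply: nonpendent_edge_leif; rewrite inE pe.
Qed.

Lemma Q_split : Q = \sum_(e in nonpendent_edges) s e ^+ 2 +
  \sum_(e in pendent_edges) (s e ^+ 2 - (delta + 1) ^+ 2).
Proof.
rewrite /Q -natrM -natrD forgotten_zagreb2 natr_sum.
under eq_bigr do rewrite natrX natrD -/(s _).
rewrite sum_edges sumrB sumr_const card_pendent_edges // -mulr_natl -/p.
by ring.
Qed.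

(** Cauchy-Schwarz uses the first sum of [Q_split]; the second is nonnegative, as a non-pendent end
    has degree at least [delta]. *)
Lemma S1_sqr_le : S1 ^+ 2 <= k * Q.
Proof.
apply: le_trans (sqr_sum_le _ _) _; rewrite ler_wpM2l ?ler0n // Q_split lerDl.
apply: sumr_ge0 => e /pendent_edge_cases[x [px -> _ _]].
rewrite subr_ge0 lerXn2r ?nnegrE ?addr_ge0 ?ler0n // lerD2r ler_nat.
exact: min_nonpendent_le.
Qed.

Lemma S1_le : S1 <= Num.sqrt (k * Q).
Proof.
rewrite -[S1]ger0_norm; last by rewrite sumr_ge0 // => e _; rewrite addr_ge0 ?ler0n.
by rewrite -sqrtr_sqr ler_wsqrtr // S1_sqr_le.
Qed.

Lemma S1_tight : (forall e, e \in edges G -> tight_edge e) ->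
  (S1 == Num.sqrt (k * Q)) =
  [|| #|nonpendent_edges| == 0, num_pendent G == 0
    | max_deg G == min_nonpendent_deg G]%N.
Proof.
move=> te.
have sN e : e \in nonpendent_edges -> s e = 2 * delta.
  move=> ne; have := te e; rewrite nonpendent_edge_tightE //.
  case/setDP: ne => -> _ /(_ isT) /andP[/eqP e1 /eqP e2].
  by rewrite /s e1 e2 mulr_natl.
have sP e : e \in pendent_edges -> s e = Delta + 1.
  move=> pe; have := te e (subsetP pendent_edges_sub e pe).
  by have [x [_ -> _ ->]] := pendent_edge_cases pe => /eqP->.
have S1E : S1 = k * (2 * delta).
  by rewrite /S1 (eq_bigr _ sN) sumr_const -[LHS]mulr_natl.
have QE : Q = k * (2 * delta) ^+ 2 + p * ((Delta + 1) ^+ 2 - (delta + 1) ^+ 2).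
  rewrite Q_split; congr (_ + _).
    by rewrite (eq_bigr _ (fun e ne => congr1 (fun a => a ^+ 2) (sN e ne)))
      sumr_const -[LHS]mulr_natl.
  rewrite (eq_bigr (fun=> (Delta + 1) ^+ 2 - (delta + 1) ^+ 2)).
    by rewrite sumr_const card_pendent_edges // -[LHS]mulr_natl.
  by move=> e /sP->.
have d0 := delta_gt0; have k0 : 0 <= k by rewrite ler0n.
have S0 : 0 <= S1 by rewrite S1E !mulr_ge0 // ltW.
have kQ0 : 0 <= k * Q := le_trans (sqr_ge0 _) S1_sqr_le.
(* Both sides are nonnegative, so squares are compared; their difference factors, and its factors
   that can vanish are the three alternatives. *)
rewrite -(eqrXn2 (_ : 0 < 2)%N S0 (sqrtr_ge0 _)) // sqr_sqrtr // eq_sym -subr_eq0.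
have -> : k * Q - S1 ^+ 2 = k * (p * ((Delta - delta) * (Delta + delta + 2))).
  by rewrite S1E QE; ring.
have D0 : Delta + delta + 2 != 0.
  by rewrite gt_eqF // ltr_wpDl ?addr_ge0 ?ler0n ?ltr0n.
by rewrite !mulf_eq0 (negPf D0) orbF subr_eq0 !pnatr_eq0 eqr_nat.
Qed.

(** Equality of the ends of [AG R G <= p * W + (2 * delta)^-1 * S1 <= bound] forces equality in both
    steps; [tight_edgesP] combines the two conditions. *)
Lemma AG_bound :
  let bound := p * W + (2 * delta)^-1 * Num.sqrt (k * Q) in
  AG R G <= bound /\
  (AG R G = bound <-> forall x, ~~ pendent x -> deg x = max_deg G).
Proof.
have d0 : 0 < (2 * delta)^-1 by rewrite invr_gt0 mulr_gt0 ?delta_gt0.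
have leT : p * W + (2 * delta)^-1 * S1 <=
    p * W + (2 * delta)^-1 * Num.sqrt (k * Q).
  by rewrite lerD2l ler_pM2l // S1_le.
have [leA eqA] := AG_leif; split; first exact: le_trans leA leT.
rewrite -tight_edgesP; split=> [E|[te]].
  have te : forall e, e \in edges G -> tight_edge e.
    by apply/forall_inP; rewrite -eqA eq_le leA /= E.
  split=> //; rewrite -S1_tight // eq_le S1_le /=.
  by rewrite -(ler_pM2l d0) -(lerD2l (p * W)) -E.
rewrite -S1_tight // => /eqP <-; apply/eqP; rewrite eqA.
exact/forall_inP.
Qed.

End Bound.

(** * Extremal graphs and the final bound *)

Lemma extremalP (G : sgraph) : connected G -> (exists x : G, ~~ pendent x) ->
  (forall x : G, ~~ pendent x -> deg x = max_deg G) <->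
  [\/ isomorphic G (complete_bipartite 1 #|G|.-1), regular G
    | semiregular G (max_deg G) 1].
Proof.
move=> Gconn [z pz]; split=> [maxG|].
  (* A pendent vertex makes the graph semiregular; otherwise it is regular. *)
  case: (pickP (@pendent G)) => [y py|np].
    apply: Or33; exists [set x | ~~ pendent x], [set x | pendent x].
    split; first by apply/setP => x; rewrite !inE orNb.
    - by apply/pred0P => x /=; rewrite !inE andNb.
    - by apply/set0Pn; exists z; rewrite inE.
    - by apply/set0Pn; exists y; rewrite inE.
    by split=> x; rewrite inE; [apply: maxG | move/eqP].
  by apply: Or32; exists (max_deg G) => x; rewrite maxG ?np.
case=> [[f [bf fadj]]|[r degr]|[V1 [V2 [V12 _ _ _ [dV1 dV2]]]]] x px.
- have degf := isomorphic_deg bf fadj.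
  (* Leaves of the star have degree 1, so only its centre can be non-pendent. *)
  have fx y : ~~ pendent y -> f y = inl ord0.
    rewrite /pendent -degf; case: (f y) => i; first by rewrite ord1.
    by rewrite star_deg_inr.
  apply/eqP; rewrite eqn_leq deg_le_max /=; apply/bigmax_leqP => y _.
  rewrite -(degf x) (fx x px) star_deg_inl -(degf y); case: (f y) => i.
    by rewrite star_deg_inl.
  by rewrite star_deg_inr; apply: leq_ltn_trans (ltn_ord i).
- have [|y <-] := max_deg_attained (G := G); last by rewrite !degr.
  by apply/card_gt0P; exists x.
have : x \in V1 :|: V2 by rewrite V12 inE.
case/setUP => [/dV1//|/dV2 dx].
by rewrite /pendent dx in px.
Qed.

Theorem theorem1 (R : rcfType) (G : sgraph) (n m Delta delta1 p F M2 : nat)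
    (Gconn : connected G)
    (Gnonpendent : exists x : G, ~~ pendent x)
    (n_def : n = #|G|)
    (m_def : m = num_edges G)
    (Delta_def : Delta = max_deg G)
    (delta1_def : delta1 = min_nonpendent_deg G)
    (p_def : p = num_pendent G)
    (F_def : F = forgotten_index G)
    (M2_def : M2 = zagreb2 G) :
  let bound : R :=
    p%:R * (Delta%:R + 1) / (2 * Num.sqrt Delta%:R)
    + (2 * delta1%:R)^-1
      * Num.sqrt ((m%:R - p%:R)
                  * (F%:R + 2 * M2%:R - p%:R * (delta1%:R + 1) ^+ 2)) in
  AG R G <= bound
  /\ (AG R G = bound <->
      [\/ isomorphic G (complete_bipartite 1 n.-1),
          regular G
        | semiregular G Delta 1]).
Proof.
move=> bound; rewrite {}/bound; subst n m Delta delta1 p F M2.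
case: (ltnP 1 #|G|) => [G1|G1].
  have := AG_bound Gconn G1 Gnonpendent R => /=.
  rewrite card_nonpendent_edges natrB ?subset_leq_card ?pendent_edges_sub //.
  rewrite card_pendent_edges // -mulrA => -[le eqv]; split=> //.
  exact: iff_trans eqv (extremalP Gconn Gnonpendent).
(* A single vertex remains: there are no edges, both sides vanish, and the graph is regular of
   degree 0. *)
have G0 (x y : G) : adj x y = false.
  by rewrite (fintype_le1P G1 x y) adj_irrefl.
have deg0 (x : G) : deg x = 0%N by apply: eq_card0 => y; rewrite inE G0.
have E0 : edges G = set0 by apply/setP => e; rewrite !inE G0.
have p0 : num_pendent G = 0%N.
  by apply: eq_card0 => x; rewrite inE /pendent deg0.
rewrite /AG /num_edges E0 big_set0 cards0 p0 !mul0r subrr mul0r sqrtr0 mulr0.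
by rewrite addr0; split=> //; split=> // _; apply: Or32; exists 0%N.
Qed.
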